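(* If $X$ is a convergent left-monomial $1$-polygraph, and $\preccurlyeq$ is a monomial order on $\mathcal{A}(X_0)$ that is compatible with $X_1$, then the set $\partial(X_1)$ of boundaries of $1$-cells of $X$ is a Gröbner basis for $(I(X),\preccurlyeq)$. Conversely, let $X$ be a set, let $\preccurlyeq$ be a monomial order on $\mathcal{A}(X)$, let $I$ be an ideal of $\mathcal{A}(X)$ and $\mathcal{G}$ be a subset of $I$. Define $\mathrm{Lead}(\mathcal{G})$ as the $1$-polygraph with set of $0$-cells $X$ and one $1$-cell $$\alpha_a:\ \mathrm{lm}(a)\ \longrightarrow\ \mathrm{lm}(a)-\frac{1}{\mathrm{lc}(a)}\,a$$ for each nonzero $a$ in $\mathcal{G}$. If $\mathcal{G}$ is a Gröbner basis for $(I,\preccurlyeq)$, then $\mathrm{Lead}(\mathcal{G})$ is a convergent left-monomial presentation of $\mathcal{A}(X)/I$, such that $I(\mathrm{Lead}(\mathcal{G}))=I$, and $\preccurlyeq$ is compatible with $\mathrm{Lead}(\mathcal{G})_1$.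
   Context: Fix a field $\mathbb{K}$; algebras are unital associative $\mathbb{K}$-algebras; $\mathcal{A}(S)$ is the free algebra on a set $S$, with linear basis the free monoid $S^*$, whose elements are called monomials; $\mathrm{supp}(a)$ is the set of monomials with nonzero coefficient in $a$. A $1$-polygraph $X=\langle X_0\,|\,X_1\rangle$ is a set $X_0$ (of $0$-cells) and a set $X_1$ (of $1$-cells) with two maps $s,t:X_1\to\mathcal{A}(X_0)$; $\alpha:a\to b$ means $s(\alpha)=a$, $t(\alpha)=b$. $I(X)$ is the two-sided ideal of $\mathcal{A}(X_0)$ generated by the boundaries $\partial(\alpha)=s(\alpha)-t(\alpha)$, $\alpha\in X_1$; $X$ is a presentation of an algebra $A$ if $A\simeq\mathcal{A}(X_0)/I(X)$. $X$ is left-monomial if, for each $\alpha\in X_1$, $s(\alpha)$ is a monomial not belonging to $\mathrm{supp}(t(\alpha))$. For left-monomial $X$, a rewriting step replaces $\lambda us(\alpha)v+a$ by $\lambda ut(\alpha)v+a$, for $\alpha\in X_1$, $u,v$ monomials, $\lambda\ne0$ a scalar and $a\in\mathcal{A}(X_0)$ with $us(\alpha)v\notin\mathrm{supp}(a)$. $X$ terminates if the smallest transitive relation $\succ_X$ on $X_0^*$, stable by product and with $s(\alpha)\succ_Xv$ for all $\alpha\in X_1$, $v\in\mathrm{supp}(t(\alpha))$, is wellfounded; $X$ is confluent if any two elements obtained from a common one by finite sequences of rewriting steps can be rewritten, by finite sequences of rewriting steps, into a common element. Convergent means terminating and confluent. A monomial order on $\mathcal{A}(S)$ is a wellfounded total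 order $\preccurlyeq$ on $S^*$ whose strict part is stable by product ($u\succ u'$ implies $vuw\succ vu'w$). It is compatible with $X_1$ (where $X$ is a left-monomial $1$-polygraph with $X_0=S$) if $s(\alpha)\succ v$ for every $\alpha\in X_1$ and $v\in\mathrm{supp}(t(\alpha))$. For a nonzero $a\in\mathcal{A}(S)$, $\mathrm{lm}(a)$ is the $\preccurlyeq$-maximum of $\mathrm{supp}(a)$ and $\mathrm{lc}(a)$ is its coefficient in $a$; $\mathrm{lm}(0)=0$. For an ideal $I$ of $\mathcal{A}(S)$, a Gröbner basis for $(I,\preccurlyeq)$ is a subset $\mathcal{G}$ of $I$ such that the ideals of $\mathcal{A}(S)$ generated by $\mathrm{lm}(I)$ and by $\mathrm{lm}(\mathcal{G})$ coincide. *)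

(* Defs.v *)
From HB Require Import structures.
From Stdlib Require Export Relation_Operators.
From mathcomp Require Export all_boot all_order all_algebra.
From mathcomp Require Export boolp classical_sets finmap.
From mathcomp.multinomials Require Export monalg.

Set Implicit Arguments.
Unset Strict Implicit.
Unset Printing Implicit Defensive.

Import GRing.Theory.

Local Open Scope ring_scope.
Local Open Scope classical_set_scope.
Local Open Scope quotient_scope.

(* A unital associative K-algebra, given by its structure map k |-> k * 1. The
   library's algType excludes the zero ring, which is needed here because
   A(X)/I is zero when I is the whole of A(X). *)
HB.mixin Record PzRing_isPzAlgebra (K : comPzRingType) A of GRing.PzRing A := {
  scalar_map : K -> A;
  scalar_map_zmod : zmod_morphism scalar_map;
  scalar_map_monoid : monoid_morphism scalar_map;
  scalar_map_central : forall (k : K) (x : A), GRing.comm (scalar_map k) x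
}.

#[short(type="pzAlgType")]
HB.structure Definition PzAlgebra (K : comPzRingType) :=
  {A of GRing.PzRing A & PzRing_isPzAlgebra K A}.

Definition alg_isomorphic (K : comPzRingType) (A B : pzAlgType K) : Prop :=
  exists f : {rmorphism A -> B},
    bijective f /\ forall k : K, f (scalar_map k) = scalar_map k.

Definition ideal_closed (A : pzRingType) (I : set A) : Prop :=
  [/\ I 0,
      forall x y, I x -> I y -> I (x + y),
      forall a x, I x -> I (a * x) &
      forall a x, I x -> I (x * a)].

Record two_sided_ideal (A : pzRingType) := TwoSidedIdeal {
  ideal_set :> set A;
  idealP : ideal_closed ideal_set
}.

Lemma generated_ideal_closed (A : pzRingType) (G : set A) :
  ideal_closed (smallest (@ideal_closed A) G).
Proof.
split.
- by move=> J [[J0 _ _ _] _].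
- move=> x y Ix Iy J HJ; case: (HJ) => -[_ JD _ _] _.
  by apply: JD; [apply: Ix|apply: Iy].
- by move=> a x Ix J HJ; case: (HJ) => -[_ _ Jl _] _; apply: Jl; apply: Ix.
- by move=> a x Ix J HJ; case: (HJ) => -[_ _ _ Jr] _; apply: Jr; apply: Ix.
Qed.

Definition generated_ideal (A : pzRingType) (G : set A) : two_sided_ideal A :=
  TwoSidedIdeal (generated_ideal_closed G).

Section QuotientAlgebra.
Context (K : comPzRingType) (A : pzAlgType K) (I : two_sided_ideal A).

Definition ideal_pred : {pred A} := fun x => `[< ideal_set I x >].

Fact ideal_pred_zmod_closed : zmod_closed ideal_pred.
Proof.
case: (idealP I) => I0 ID Il _; split; first exact/asboolP.
move=> x y /asboolP Ix /asboolP Iy; apply/asboolP.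
by apply: ID => //; rewrite -mulN1r; apply: Il.
Qed.

HB.instance Definition _ :=
  GRing.isZmodClosed.Build A ideal_pred ideal_pred_zmod_closed.

Definition quot_alg : Type := Quotient.quot (ideal_pred : zmodClosed A).

HB.instance Definition _ := GRing.Zmodule.on quot_alg.
HB.instance Definition _ := EqQuotient.on quot_alg.
HB.instance Definition _ := ZmodQuotient.on quot_alg.

Lemma quot_algP (x y : A) : reflect (ideal_set I (x - y)) (x == y %[mod quot_alg]).
Proof.
rewrite -(Quotient.idealrBE (ideal_pred : zmodClosed A)); exact: asboolP.
Qed.

Definition qone : quot_alg := lift_cst quot_alg 1.
Definition qmul := lift_op2 quot_alg *%R.
Definition qscalar (k : K) : quot_alg := \pi_quot_alg (scalar_map k).

Canonical pi_qone_morph := PiConst qone.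

Fact pi_qmul : {morph \pi : x y / x * y >-> qmul x y}.
Proof.
case: (idealP I) => _ ID Il Ir x y; unlock qmul; apply/eqP/quot_algP.
set x' := repr _; set y' := repr _.
have -> : x * y - x' * y' = (x - x') * y + x' * (y - y').
  by rewrite mulrBl mulrBr addrA subrK.
apply: ID; [apply: Ir|apply: Il]; apply/quot_algP; by rewrite reprK.
Qed.
Canonical pi_qmul_morph := PiMorph2 pi_qmul.

Fact qmulA : associative qmul.
Proof. by move=> x y z; rewrite -[x]reprK -[y]reprK -[z]reprK !piE mulrA. Qed.
Fact qmul1 : left_id qone qmul.
Proof. by move=> x; rewrite -[x]reprK !piE mul1r. Qed.
Fact qmulr1 : right_id qone qmul.
Proof. by move=> x; rewrite -[x]reprK !piE mulr1. Qed.
Fact qmulDl : left_distributive qmul +%R.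
Proof. by move=> x y z; rewrite -[x]reprK -[y]reprK -[z]reprK !piE mulrDl. Qed.
Fact qmulDr : right_distributive qmul +%R.
Proof. by move=> x y z; rewrite -[x]reprK -[y]reprK -[z]reprK !piE mulrDr. Qed.

HB.instance Definition _ := GRing.Zmodule_isPzRing.Build quot_alg
  qmulA qmul1 qmulr1 qmulDl qmulDr.

Fact qscalar_zmod : zmod_morphism qscalar.
Proof.
by move=> a b; rewrite /qscalar (scalar_map_zmod a b) !piE.
Qed.
Fact qscalar_monoid : monoid_morphism qscalar.
Proof.
case: (@scalar_map_monoid K A) => h1 hM; split; first by rewrite /qscalar h1 piE.
by move=> a b; rewrite /qscalar hM [RHS]/GRing.mul /= !piE.
Qed.
Fact qscalar_central (k : K) (x : quot_alg) : GRing.comm (qscalar k) x.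
Proof.
rewrite /GRing.comm -[x]reprK /qscalar /GRing.mul /= !piE.
by rewrite scalar_map_central.
Qed.

HB.instance Definition _ := PzRing_isPzAlgebra.Build K quot_alg
  qscalar_zmod qscalar_monoid qscalar_central.

End QuotientAlgebra.

Section MonoidAlgebra.
Context (M : monomType) (K : comNzRingType).

Fact malgC_central (k : K) (x : {malg K[M]}) : GRing.comm (k%:MP) x.
Proof.
rewrite /GRing.comm mul_malgC; apply/malgP => m.
rewrite mcoeffZ (mcoeffMrw m (fsubset_refl _) (msuppC_le k)) big_seq_fset1.
rewrite {1}[x]monalgE raddf_sum /= mulr_sumr; apply: eq_bigr => u _.
by rewrite mulm1 mcoeffC eqxx mulr1n mcoeffU mulrnAr mulrC.
Qed.

HB.instance Definition _ := PzRing_isPzAlgebra.Build K (malg M K)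
  (@monalgUB M K mone) (conj (@mpolyC1E M K) (@mpolyCM M K)) malgC_central.
End MonoidAlgebra.

(* {fmonom S} is the free monoid on S; a monomial m is seen in the free algebra
   as << m >>. *)
Notation free_alg K S := {malg K[{fmonom S}]}.

Record polygraph (K : fieldType) (X0 : choiceType) := Polygraph {
  cell1 : Type;
  src : cell1 -> free_alg K X0;
  tgt : cell1 -> free_alg K X0
}.

Section Polygraph.
Context (K : fieldType) (X0 : choiceType) (X : polygraph K X0).

Definition boundary (alpha : cell1 X) : free_alg K X0 := src alpha - tgt alpha.

Definition boundaries : set (free_alg K X0) := range boundary.

Definition polygraph_ideal : two_sided_ideal (free_alg K X0) :=
  generated_ideal boundaries.

Definition presentation (A : pzAlgType K) : Prop :=
  alg_isomorphic A (quot_alg polygraph_ideal).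

Definition left_monomial : Prop :=
  forall alpha : cell1 X,
    exists2 m : {fmonom X0}, src alpha = << m >> & m \notin msupp (tgt alpha).

(* Sources are named through monomials m with src alpha = << m >>; for a
   left-monomial X this covers every 1-cell. *)
Inductive rstep : free_alg K X0 -> free_alg K X0 -> Prop :=
| RStep (alpha : cell1 X) (m u v : {fmonom X0}) (k : K) (a : free_alg K X0) :
    src alpha = << m >> -> k != 0 -> mmul (mmul u m) v \notin msupp a ->
    rstep (k *: (<< u >> * src alpha * << v >>) + a)
          (k *: (<< u >> * tgt alpha * << v >>) + a).

Definition rewrites := clos_refl_trans (free_alg K X0) rstep.

(* The smallest transitive relation that is stable by product and contains the
   base pairs. *)
Inductive succX : {fmonom X0} -> {fmonom X0} -> Prop :=
| SuccCell (alpha : cell1 X) m v :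
    src alpha = << m >> -> v \in msupp (tgt alpha) -> succX m v
| SuccProd u u' v w :
    succX u u' -> succX (mmul (mmul v u) w) (mmul (mmul v u') w)
| SuccTrans u v w : succX u v -> succX v w -> succX u w.

Definition terminating : Prop := well_founded (fun v u => succX u v).

Definition confluent : Prop :=
  forall a b c, rewrites a b -> rewrites a c ->
  exists d, rewrites b d /\ rewrites c d.

Definition convergent : Prop := terminating /\ confluent.

End Polygraph.

Section MonomialOrder.
(* le u v reads u \preccurlyeq v. *)
Context (S : choiceType) (le : rel {fmonom S}).

Definition strict (u v : {fmonom S}) : bool := (u != v) && le u v.

Record monomial_order : Prop := MonomialOrder {
  mo_refl : reflexive le;
  mo_anti : antisymmetric le;
  mo_trans : transitive le;
  mo_total : total le;
  mo_wf : well_founded strict;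
  mo_mul : forall u u' v w : {fmonom S}, strict u' u ->
    strict (mmul (mmul v u') w) (mmul (mmul v u) w)
}.

Context (K : fieldType).

Definition compatible (X : polygraph K S) : Prop :=
  forall (alpha : cell1 X) (m v : {fmonom S}),
    src alpha = << m >> -> v \in msupp (tgt alpha) -> strict v m.

(* The maximum of the support of a; the default value is reached only for
   a = 0 when le is total. *)
Definition lead_mon (a : free_alg K S) : {fmonom S} :=
  head (mone : {fmonom S}) [seq m <- msupp a | all (le^~ m) (msupp a)].

Definition lc (a : free_alg K S) : K := a@_(lead_mon a).

Definition lm (a : free_alg K S) : free_alg K S :=
  if a == 0 then 0 else << lead_mon a >>.

Definition grobner_basis (I G : set (free_alg K S)) : Prop :=
  G `<=` I /\
  generated_ideal (lm @` I) = generated_ideal (lm @` G) :> set (free_alg K S).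

Definition Lead (G : set (free_alg K S)) : polygraph K S :=
  @Polygraph K S {a : free_alg K S | (a \in G) && (a != 0)}
    (fun a => lm (val a))
    (fun a => lm (val a) - (lc (val a))^-1 *: val a).

End MonomialOrder.

(* Main.v *)
Require Import Defs.
From Stdlib Require Import Operators_Properties.

Set Implicit Arguments.
Unset Strict Implicit.
Unset Printing Implicit Defensive.

Import GRing.Theory.

(** Both directions meet in one reformulation ([grobner_basisP]): since a
    monomial ideal contains a monomial [n] exactly when [n] is a multiple of one
    of its monomial generators, a subset [G] of [I] is a Groebner basis exactly
    when the leading monomial of every nonzero element of [I] is a multiple of
    the leading monomial of some nonzero element of [G].

    Rewriting is handled through linear maps.  For a 1-cell [alpha] with source
    [m] and monomials [u], [v], the map [reduce alpha u m v] subtracts from [a]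
    the multiple of [u * boundary alpha * v] that cancels the coefficient of
    [umv].  Every rewriting step is an instance of such a map
    ([rstep_reduce]), and conversely [a] always rewrites to its image, in one
    step or in none ([rewrites_reduce]).  Linearity replaces every case
    analysis on whether monomials cancel.

    Suppose first that [X] is confluent.  The map [reduce alpha u m v] is
    linear and idempotent, so [a + c] and [reduce alpha u m v a + c] have the
    same image under it; hence joinability is compatible with addition
    ([joinableD]).  The elements that rewrite to 0 are thus stable by sums; they
    contain the multiples of boundaries, so they contain the whole ideal
    ([ideal_rewrites0]).  A nonzero element whose leading monomial is
    irreducible cannot rewrite to 0, because with a compatible order each step
    then keeps that leading monomial ([rewrites0_reducible]).  So leading
    monomials of the ideal are reducible, that is, multiples of the leading
    monomial of a boundary.

    Conversely, let [I] be an ideal that contains [I(X)] and in which every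
    nonzero element has a reducible leading monomial.  If [a - b] is in [I] and nonzero, applying to both [a]
    and [b] the map that cancels the leading term of [a - b] replaces [a - b] by
    an element of [I] which is 0 or has a smaller leading monomial; wellfounded
    induction on that monomial shows that [a] and [b] are joinable
    ([reducible_joinable]).  For [X = Lead G] this gives confluence, and, with
    [b = 0], that [I] is contained in [I(Lead G)].  Termination holds because
    rewriting only decreases monomials for a compatible wellfounded order. *)

Local Open Scope ring_scope.
Local Open Scope classical_set_scope.

(** * Ideals and monomials of the free algebra *)

Lemma generated_ideal_sub (A : pzRingType) (G : set A) (I : two_sided_ideal A) :
  G `<=` I -> generated_ideal G `<=` I.
Proof. by move=> GI x; apply; split => //; exact: idealP. Qed.

Lemma sub_generated_ideal (A : pzRingType) (G : set A) : G `<=` generated_ideal G.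
Proof. by move=> x Gx J [_ GJ]; apply: GJ. Qed.

Lemma idealN (A : pzRingType) (I : two_sided_ideal A) x :
  ideal_set I x -> ideal_set I (- x).
Proof. by case: (idealP I) => _ _ Il _ Ix; rewrite -mulN1r; apply: Il. Qed.

Lemma idealB (A : pzRingType) (I : two_sided_ideal A) x y :
  ideal_set I x -> ideal_set I y -> ideal_set I (x - y).
Proof. by case: (idealP I) => _ ID _ _ Ix /idealN; apply: ID. Qed.

Lemma addr_subKB (V : zmodType) (x y z : V) : x + z - (x - y) = y + z.
Proof. by rewrite opprB addrC subrKA. Qed.

Lemma two_sided_ideal_inj (A : pzRingType) (I J : two_sided_ideal A) :
  I = J :> set A -> I = J.
Proof.
case: I J => [I PI] [J PJ] /= E; case: J / E PJ => PJ.
by rewrite (Prop_irrelevance PI PJ).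
Qed.

Section FreeAlgebra.
Context (K : fieldType) (S : choiceType).
Local Notation A := (free_alg K S).
Implicit Types (u v m n w : {fmonom S}) (a b c : A) (k : K).

Local Notation "u ** v" := (mmul u v) (at level 40, left associativity).

(** The free monoid is cancellative: this is what makes multiplication by
    monomials permute coefficients without merging them. *)
Lemma fmonom_mulIm u v m n : u ** m ** v = u ** n ** v -> m = n.
Proof.
move=> /(congr1 (@fmonom_val S)); rewrite !fmM => E.
have sz : size (u ++ m) = size (u ++ n).
  by have /(congr1 size) := E; rewrite (size_cat _ v) (size_cat _ v) => /addIn.
move/eqP: E; rewrite eqseq_cat // eqseq_cat // !eqxx andbT /= => /eqP E.
exact: val_inj.
Qed.

(** Scalars are central, although the monoid is not commutative. *)
Lemma mulrZl_malg k a b : a * (k *: b) = k *: (a * b).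
Proof.
by rewrite -mul_malgC mulrA -[a * _](malgC_central k a) -mulrA mul_malgC.
Qed.

Lemma idealZ (I : two_sided_ideal A) k a :
  ideal_set I a -> ideal_set I (k *: a).
Proof. by case: (idealP I) => _ _ Il _ Ia; rewrite -mul_malgC; apply: Il. Qed.

Lemma translateE u v b : << u >> * b * << v >> =
  \sum_(m <- msupp b) << b@_m *g u ** m ** v >> :> A.
Proof.
rewrite {1}[b]monalgE mulr_sumr mulr_suml; apply: eq_bigr => m _.
by rewrite !malgM_def !fgmulUU mul1r mulr1.
Qed.

Lemma mcoeff_translate u v m b : (<< u >> * b * << v >>)@_(u ** m ** v) = b@_m.
Proof.
rewrite translateE [in RHS](monalgE b) !raddf_sum /=; apply: eq_bigr => n _.
rewrite !mcoeffU; congr (_ *+ nat_of_bool _).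
by apply/eqP/eqP => [/fmonom_mulIm|->].
Qed.

Lemma msupp_translate u v b n :
  n \in msupp (<< u >> * b * << v >> : A) ->
  exists2 m, m \in msupp b & n = u ** m ** v.
Proof.
rewrite -mcoeff_neq0 translateE raddf_sum /= => nz.
have [//|no] := pselect (exists2 m, m \in msupp b & n = u ** m ** v).
case/eqP: nz; rewrite big_seq big1 // => m mb; rewrite mcoeffU.
by case: eqP => // E; case: no; exists m.
Qed.

Lemma translate_mon u m v : << u >> * << m >> * << v >> = << u ** m ** v >> :> A.
Proof. by rewrite !malgM_def !fgmulUU !mulr1. Qed.

Lemma malgU_inj m n : << m >> = << n >> :> A -> m = n.
Proof.
move/(congr1 (mcoeff n)); rewrite mcoeffUU mcoeffU.
by case: eqP => // _ /eqP; rewrite eq_sym oner_eq0.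
Qed.

(** The products [a * b * c] are linear combinations of translates of [b] by
    monomials; this reduces membership in an ideal to such translates. *)
Lemma malg_translate_ind (P : A -> Prop) b :
  P 0 -> (forall x y, P x -> P y -> P (x + y)) ->
  (forall k u v, P (k *: (<< u >> * b * << v >>))) ->
  forall a c, P (a * b * c).
Proof.
move=> P0 PD Pt a c.
rewrite [a]monalgE [c]monalgE (mulr_suml _ _ _ b).
rewrite (mulr_suml _ _ _ (\sum_(k <- _) _)).
apply: (big_ind P) => // u _; rewrite mulr_sumr; apply: (big_ind P) => // v _.
have E k w : << k *g w >> = k *: << w >> :> A.
  by rewrite -mul_malgC malgM_def fgmulUU mul1m mulr1.
by rewrite (E _ u) (E _ v) -!scalerAl mulrZl_malg scalerA.
Qed.

End FreeAlgebra.

(** * Leading monomials *)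

Section LeadingMonomial.
Context (K : fieldType) (S : choiceType) (le : rel {fmonom S}).
Context (leO : monomial_order le).
Local Notation A := (free_alg K S).
Local Notation lt := (strict le).
Implicit Types (u v m n w : {fmonom S}) (a b c : A).

Local Notation "u ** v" := (mmul u v) (at level 40, left associativity).

Lemma exists_max (s : seq {fmonom S}) :
  s != [::] -> exists2 m, m \in s & all (le^~ m) s.
Proof.
case: leO => refl _ trans total _ _.
elim: s => // x s IH _; have [->|/IH[m ms mP]] := eqVneq s [::].
  by exists x; rewrite ?inE //= refl.
have /orP[xm|mx] := total x m.
  by exists m; [rewrite in_cons ms orbT|rewrite /= xm].
exists x; first by rewrite in_cons eqxx.
by rewrite /= refl; apply/allP => z /(allP mP) zm; exact: trans zm mx.
Qed.

Lemma lead_monP a : a != 0 ->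
  lead_mon le a \in msupp a /\ forall n, n \in msupp a -> le n (lead_mon le a).
Proof.
move=> a0; rewrite /lead_mon; set s := [seq _ <- _ | _].
have [|m ma mP] := @exists_max (msupp a).
  apply: contra_neq a0 => E; apply/malgP => n; rewrite mcoeff0.
  apply: mcoeff_outdom; suff : n \notin (msupp a : seq _) by [].
  by rewrite E.
have : head (mone : {fmonom S}) s \in s.
  have : m \in s by rewrite mem_filter mP ma.
  by case: (s) => //= x t _; rewrite inE eqxx.
by rewrite mem_filter => /andP[/allP hP ->]; split.
Qed.

Lemma lead_mon_unique a m :
  m \in msupp a -> (forall n, n \in msupp a -> le n m) -> lead_mon le a = m.
Proof.
move=> ma mP; have a0 : a != 0 by apply: contraTneq ma => ->; rewrite msupp0.
have [la lP] := lead_monP a0.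
by apply: (mo_anti leO); rewrite mP //= lP.
Qed.

Lemma le_strict m n : le m n -> m = n \/ lt m n.
Proof.
by move=> mn; case: (eqVneq m n) => [|ne]; [left|right; rewrite /strict ne].
Qed.

Lemma strictNge m n : lt m n -> ~~ le n m.
Proof.
move=> /andP[ne mn]; apply: contra ne => nm; apply/eqP.
by apply: (mo_anti leO); rewrite mn.
Qed.

Lemma le_translate u v m n : le m n -> le (u ** m ** v) (u ** n ** v).
Proof.
move/le_strict => [->|/(mo_mul leO u v)/andP[]//]; exact: mo_refl.
Qed.

Lemma strict_trans m n w : lt m n -> lt n w -> lt m w.
Proof.
move=> mn /andP[_ nw]; apply/andP; split; last first.
  by apply: mo_trans nw => //; case/andP: mn.
by apply: contraTneq nw => <-; apply: strictNge.
Qed.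

(** The elements whose support consists of multiples of the leading monomials of
    [G] form an ideal, because supports of sums and products are made of
    monomials, resp. products of monomials, of the operands. *)
Lemma monomial_ideal_mem (G : set A) n :
  ideal_set (generated_ideal (@lm S le K @` G)) << n >> ->
  exists g u v, [/\ G g, g != 0 & n = u ** lead_mon le g ** v].
Proof.
pose D m := exists g u v, [/\ G g, g != 0 & m = u ** lead_mon le g ** v].
suff H : forall a, ideal_set (generated_ideal (@lm S le K @` G)) a ->
  forall m, m \in msupp a -> D m.
  by move=> /H; apply; rewrite msuppU1 inE.
have DM w w' m : D m -> D (w ** m ** w').
  case=> g [u [v [Gg g0 ->]]]; exists g, (w ** u), (v ** w'); split=> //.
  by rewrite !mulmA.
have D_ideal : ideal_closed [set a : A | forall m, m \in msupp a -> D m].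
  split => /= [m|x y Dx Dy m|x y Dy m|x y Dy m].
  - by rewrite msupp0.
  - by move/(fsubsetP (msuppD_le _ _)); rewrite inE => /orP[/Dx|/Dy].
  - move/msuppM_le => [k1 [k2 [_ /Dy Dk ->]]].
    by rewrite -[_ ** k2]mulm1; apply: DM.
  - move/msuppM_le => [k1 [k2 [/Dy Dk _ ->]]].
    by rewrite -[k1]mul1m; apply: DM.
apply: (@generated_ideal_sub _ _ (TwoSidedIdeal D_ideal)).
move=> _ [g Gg <-] m; rewrite /lm; case: eqVneq => [_|g0].
  by rewrite msupp0.
rewrite msuppU1 inE => /eqP ->; exists g, mone, mone; split=> //.
by rewrite mulm1 mul1m.
Qed.

(** The form in which the Groebner property is used below: equality of the two
    monomial ideals becomes divisibility of leading monomials. *)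
Lemma grobner_basisP (I G : set A) : grobner_basis le I G <->
  G `<=` I /\ forall a, I a -> a != 0 ->
    exists g u v, [/\ G g, g != 0 & lead_mon le a = u ** lead_mon le g ** v].
Proof.
split=> -[GI H]; split => //.
  move=> a Ia a0; apply: monomial_ideal_mem; rewrite -H.
  by apply: sub_generated_ideal; exists a; rewrite // /lm (negPf a0).
apply/seteqP; split; apply: generated_ideal_sub => _ [a Ia <-]; last first.
  by apply: sub_generated_ideal; exists a => //; apply: GI.
case: (idealP (generated_ideal (@lm S le K @` G))) => I0 _ Il Ir.
rewrite /lm; case: eqVneq => [_|/(H a Ia)]; first exact: I0.
move=> [g [u [v [Gg g0 ->]]]]; rewrite -translate_mon; apply: Ir; apply: Il.
by apply: sub_generated_ideal; exists g; rewrite // /lm (negPf g0).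
Qed.

End LeadingMonomial.

(** * Rewriting as a linear operation *)

Section Reduction.
Context (K : fieldType) (S : choiceType) (X : polygraph K S).
Local Notation A := (free_alg K S).
Implicit Types (alpha : cell1 X) (u v m n : {fmonom S}) (a b c : A).

Local Notation "u ** v" := (mmul u v) (at level 40, left associativity).

(** A rewriting step, extended by the identity to the elements where the
    monomial [umv] does not occur; the extension is what makes it linear.  It is
    meant for [m] the source of [alpha]. *)
Definition reduce alpha u m v a : A :=
  a - a@_(u ** m ** v) *: (<< u >> * boundary alpha * << v >>).

Definition reducible n : Prop :=
  exists alpha u m v, src alpha = << m >> /\ n = u ** m ** v.

Lemma reduceD alpha u m v a b :
  reduce alpha u m v (a + b) = reduce alpha u m v a + reduce alpha u m v b.
Proof. by rewrite /reduce mcoeffD scalerDl opprD addrACA. Qed.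

Lemma reduceN alpha u m v a : reduce alpha u m v (- a) = - reduce alpha u m v a.
Proof. by rewrite /reduce mcoeffN scaleNr opprB opprK addrC. Qed.

Lemma rewrites_reduce alpha u m v a : src alpha = << m >> ->
  rewrites X a (reduce alpha u m v a).
Proof.
move=> sm; have [c0|c0] := eqVneq a@_(u ** m ** v) 0.
  by rewrite /reduce c0 scale0r subr0; apply: rt_refl.
set k := a@_(u ** m ** v) in c0.
pose b := a - k *: << u ** m ** v >>.
have Ea : a = k *: (<< u >> * src alpha * << v >>) + b.
  by rewrite sm translate_mon addrC subrK.
have Er : reduce alpha u m v a = k *: (<< u >> * tgt alpha * << v >>) + b.
  rewrite /reduce -/k {1}Ea /boundary mulrBr mulrBl scalerBr.
  exact: (@addr_subKB A).
rewrite Er {1}Ea; apply: rt_step; apply: (RStep (m := m)) => //.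
by rewrite -mcoeff_eq0 mcoeffB mcoeffZ mcoeffUU mulr1 subrr.
Qed.

Lemma rstep_reduce a b : rstep X a b -> exists alpha u m v,
  [/\ src alpha = << m >>, u ** m ** v \in msupp a & b = reduce alpha u m v a].
Proof.
case=> alpha m u v k c sm k0 nc; exists alpha, u, m, v.
have E : (k *: (<< u >> * src alpha * << v >>) + c)@_(u ** m ** v) = k.
  rewrite mcoeffD mcoeffZ mcoeff_translate sm mcoeffUU mulr1.
  by rewrite (mcoeff_outdom nc) addr0.
split=> //; first by rewrite -mcoeff_neq0 E.
rewrite /reduce E /boundary mulrBr mulrBl scalerBr; symmetry.
exact: (@addr_subKB A).
Qed.

Lemma boundary_ideal alpha u v k :
  ideal_set (polygraph_ideal X) (k *: (<< u >> * boundary alpha * << v >>)).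
Proof.
case: (idealP (polygraph_ideal X)) => _ _ Il Ir.
by apply/idealZ; apply: Ir; apply: Il; apply: sub_generated_ideal; exists alpha.
Qed.

Lemma rewrites_ideal a b : rewrites X a b -> ideal_set (polygraph_ideal X) (a - b).
Proof.
elim=> {a b} [a b /rstep_reduce[alpha [u [m [v [_ _ ->]]]]]|a|a b c _ IH1 _ IH2].
- by rewrite /reduce opprB addrC subrK; apply: boundary_ideal.
- by rewrite subrr; case: (idealP (polygraph_ideal X)).
- rewrite -(subrKA b); case: (idealP (polygraph_ideal X)) => _ ID _ _.
  exact: ID.
Qed.

Context (Xlm : left_monomial X).

(** The source does not occur in the target, so its coefficient 1 survives in
    the boundary; this is why reductions are idempotent. *)
Lemma left_monomial_coeff alpha m : src alpha = << m >> -> (boundary alpha)@_m = 1.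
Proof.
move=> sm; have [m' sm' m't] := Xlm alpha.
have <- : m' = m by apply: (@malgU_inj K); rewrite -sm' sm.
by rewrite mcoeffB sm' mcoeffUU (mcoeff_outdom m't) subr0.
Qed.

Lemma reduce_coeff alpha u m v a : src alpha = << m >> ->
  (reduce alpha u m v a)@_(u ** m ** v) = 0.
Proof.
move=> sm; rewrite mcoeffB mcoeffZ mcoeff_translate left_monomial_coeff //.
by rewrite mulr1 subrr.
Qed.

Lemma reduceK alpha u m v a : src alpha = << m >> ->
  reduce alpha u m v (reduce alpha u m v a) = reduce alpha u m v a.
Proof.
by move=> sm; rewrite {1}/reduce (reduce_coeff u v a sm) scale0r subr0.
Qed.

Lemma reduce_boundary alpha u m v k : src alpha = << m >> ->
  reduce alpha u m v (k *: (<< u >> * boundary alpha * << v >>)) = 0.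
Proof.
move=> sm; rewrite /reduce mcoeffZ mcoeff_translate left_monomial_coeff //.
by rewrite mulr1 subrr.
Qed.

(** * Membership in the ideal of a confluent polygraph *)

Definition joinable a b := exists d, rewrites X a d /\ rewrites X b d.

Lemma rewrites0 a : rewrites X 0 a -> a = 0.
Proof.
move=> r0; have := clos_rt_rt1n _ _ _ _ r0; move E : 0 => z r {r0}.
elim: r E => // x y w /rstep_reduce[alpha [u [m [v [_ + _]]]]] _ _ E.
by rewrite -E msupp0.
Qed.

Lemma joinable_trans a b c : confluent X ->
  joinable a b -> joinable b c -> joinable a c.
Proof.
move=> Xc [d [ad bd]] [e [be ce]]; have [f [df ef]] := Xc _ _ _ bd be.
by exists f; split; [apply: rt_trans ad df|apply: rt_trans ce ef].
Qed.

(** Adding [c] may cancel the monomial that is rewritten, so [a + c] need not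
    rewrite to [b + c].  But for a single step [b] is the image of [a] under a
    linear idempotent map, so [a + c] and [b + c] have the same image. *)
Lemma joinableD a b c : confluent X -> rewrites X a b -> joinable (a + c) (b + c).
Proof.
move=> Xc; elim=> {a b} [a b|a|a b d _ IH1 _ IH2].
- move=> /rstep_reduce[alpha [u [m [v [sm _ ->]]]]].
  exists (reduce alpha u m v (a + c)); split; first exact: rewrites_reduce.
  have -> : reduce alpha u m v (a + c) =
      reduce alpha u m v (reduce alpha u m v a + c).
    rewrite (reduceD _ _ _ _ a c) (reduceD _ _ _ _ (reduce _ _ _ _ a)).
    by rewrite reduceK.
  exact: rewrites_reduce.
- by exists (a + c); split; apply: rt_refl.
- exact: joinable_trans IH1 IH2.
Qed.

(** Rewriting to 0 is stable by sums by [joinableD] and holds for the multiples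
    of boundaries.  To obtain an ideal, closure under products is built into the
    set that is considered. *)
Lemma ideal_rewrites0 a : confluent X ->
  ideal_set (polygraph_ideal X) a -> rewrites X a 0.
Proof.
move=> Xc Ia.
have r0D x y : rewrites X x 0 -> rewrites X y 0 -> rewrites X (x + y) 0.
  move=> x0 y0; have := joinableD y Xc x0; rewrite add0r => xy.
  have [|d [xyd /rewrites0 d0]] := joinable_trans Xc xy (c := 0).
    by exists 0; split => //; apply: rt_refl.
  by rewrite -d0.
have r0_ideal : ideal_closed [set x | forall b c, rewrites X (b * x * c) 0].
  split=> /= [b c|x y Hx Hy b c|y x Hx b c|y x Hx b c].
  - by rewrite mulr0 mul0r; apply: rt_refl.
  - by rewrite mulrDr mulrDl; apply: r0D.
  - by rewrite mulrA; apply: Hx.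
  - by rewrite mulrA -mulrA; apply: Hx.
(* Generalizing the two factors 1 puts the goal in the form of that ideal. *)
have -> : a = 1 * a * 1 by rewrite mul1r mulr1.
move: 1 {2}1 => b c; move: b c.
apply: (@generated_ideal_sub _ _ (TwoSidedIdeal r0_ideal)) Ia.
move=> _ [alpha _ <-].
apply: (@malg_translate_ind _ _ (fun x => rewrites X x 0)) => //.
  exact: rt_refl.
move=> k u v; have [m sm _] := Xlm alpha.
have := rewrites_reduce u v (k *: (<< u >> * boundary alpha * << v >>)) sm.
by rewrite reduce_boundary.
Qed.

(** * Leading monomials and rewriting *)

Context (le : rel {fmonom S}).
Context (leO : monomial_order le).
Context (leX : compatible le X).

Lemma boundary_le alpha m n :
  src alpha = << m >> -> n \in msupp (boundary alpha) -> le n m.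
Proof.
move=> sm /(fsubsetP (msuppB_le _ _)); rewrite sm inE msuppU1 inE.
move=> /orP[/eqP ->|nt]; first exact: mo_refl.
by have /andP[] := leX sm nt.
Qed.

Lemma lead_mon_boundary alpha m :
  src alpha = << m >> -> lead_mon le (boundary alpha) = m.
Proof.
move=> sm; apply: lead_mon_unique => // [|n]; last exact: boundary_le.
by rewrite -mcoeff_neq0 left_monomial_coeff ?oner_neq0.
Qed.

Lemma reduce_le alpha u m v a n : src alpha = << m >> ->
  n \in msupp (reduce alpha u m v a) -> n \in msupp a \/ strict le n (u ** m ** v).
Proof.
move=> sm nr; have := fsubsetP (msuppB_le _ _) _ nr; rewrite inE.
case/orP => [->|/(fsubsetP (msuppZ_le _ _))/msupp_translate]; first by left.
move=> [w wb E]; right; rewrite /strict; apply/andP; split; last first.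
  by rewrite E; apply: le_translate => //; apply: boundary_le wb.
by apply: contraTneq nr => ->; rewrite -mcoeff_eq0 reduce_coeff.
Qed.

(** Along a rewriting sequence, as long as the leading monomial is not itself
    rewritten it persists: a step at a smaller monomial only creates still
    smaller ones.  Since 0 has no monomial, it is rewritten at some point, so it
    is reducible. *)
Lemma rewrites0_reducible a :
  rewrites X a 0 -> a != 0 -> reducible (lead_mon le a).
Proof.
move=> r0; have := clos_rt_rt1n _ _ _ _ r0; move E : 0 => z r {r0}.
elim: r E => [x <-|{}a b c ab _ IH]; first by rewrite eqxx.
move=> E; case: c / E IH => /(_ erefl) IH a0; have [la lP] := lead_monP leO a0.
have [alpha [u [m [v [sm ma Eb]]]]] := rstep_reduce ab.
have [El|ml] := le_strict (lP _ ma); first by exists alpha, u, m, v.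
have lb : lead_mon le a \in msupp b.
  rewrite -mcoeff_neq0 Eb mcoeffB [X in _ - X]mcoeff_outdom ?subr0 ?mcoeff_neq0 //.
  apply/negP => /(fsubsetP (msuppZ_le _ _))/msupp_translate[w wb].
  move=> El; have := strictNge leO ml; rewrite El le_translate //.
  exact: boundary_le wb.
suff <- : lead_mon le b = lead_mon le a.
  by apply: IH; apply: contraTneq lb => ->; rewrite msupp0.
apply: lead_mon_unique => // n; rewrite Eb => /(reduce_le sm)[/lP//|nm].
by have /andP[] := strict_trans leO nm ml.
Qed.

Lemma lead_mon_reduce alpha u m v a :
  src alpha = << m >> -> lead_mon le a = u ** m ** v ->
  a != 0 -> reduce alpha u m v a != 0 ->
  strict le (lead_mon le (reduce alpha u m v a)) (lead_mon le a).
Proof.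
move=> sm El a0 r0; have [lr _] := lead_monP leO r0.
have [ls|] := reduce_le sm lr; last by rewrite -El.
have [_ /(_ _ ls) lle] := lead_monP leO a0.
have [eq|//] := le_strict lle.
have /eqP := reduce_coeff u v a sm.
by rewrite -El -{1}eq mcoeff_eq0 lr.
Qed.

(** Comparing [a] and [b] through their difference avoids normal forms: the
    leading term of [a - b] is cancelled by applying one linear reduction to
    both elements, and the order decreases on the difference. *)
Lemma reducible_joinable (I : two_sided_ideal A) :
  polygraph_ideal X `<=` I ->
  (forall a, ideal_set I a -> a != 0 -> reducible (lead_mon le a)) ->
  forall a b, ideal_set I (a - b) -> joinable a b.
Proof.
move=> XI H a b; move E : (lead_mon le (a - b)) => m.
elim/(well_founded_ind (mo_wf leO)): m a b E => l IH a b E Iab.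
have [/subr0_eq ->|ab0] := eqVneq (a - b) 0.
  by exists b; split; apply: rt_refl.
have [alpha [u [m [v [sm El]]]]] := H _ Iab ab0.
pose r := reduce alpha u m v.
have Er : r a - r b = r (a - b) by rewrite /r reduceD reduceN.
suff [d [ad bd]] : joinable (r a) (r b).
  exists d; split; [apply: rt_trans ad|apply: rt_trans bd];
  exact: rewrites_reduce.
have [/subr0_eq ->|rab0] := eqVneq (r a - r b) 0.
  by exists (r b); split; apply: rt_refl.
apply: (IH _ _ _ _ erefl); last first.
  by rewrite Er; apply: (idealB Iab); apply: XI; apply: boundary_ideal.
rewrite -E Er; rewrite Er in rab0; exact: lead_mon_reduce sm El ab0 rab0.
Qed.

Lemma compatible_terminating : terminating X.
Proof.
have sub m n : succX X m n -> strict le n m.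
  elim=> {m n} [alpha m v sm vt|m n v w _ mn|m n w _ mn _ nw].
  - exact: leX sm vt.
  - exact: (mo_mul leO).
  - exact: (strict_trans leO) nw mn.
move=> m; elim/(well_founded_ind (mo_wf leO)): m => m IH.
by constructor => n /sub/IH.
Qed.

End Reduction.

(** * Convergent polygraphs and Groebner bases *)

Section Grobner.
Context (K : fieldType) (S : choiceType) (le : rel {fmonom S}).
Context (leO : monomial_order le).
Local Notation A := (free_alg K S).

Lemma confluent_grobner (X : polygraph K S) :
  confluent X -> left_monomial X -> compatible le X ->
  grobner_basis le (polygraph_ideal X) (boundaries X).
Proof.
move=> Xc Xlm leX; apply: (proj2 (grobner_basisP _ _ _)); split.
  exact: sub_generated_ideal.
move=> a /(ideal_rewrites0 Xlm Xc) a0 an0.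
have [alpha [u [m [v [sm ->]]]]] := rewrites0_reducible Xlm leO leX a0 an0.
exists (boundary alpha), u, v; rewrite (lead_mon_boundary Xlm leO leX sm).
split=> //; first by exists alpha.
apply/eqP => b0; have := left_monomial_coeff Xlm sm.
by rewrite b0 mcoeff0 => /eqP; rewrite eq_sym oner_eq0.
Qed.

Context (I : two_sided_ideal A) (G : set A).

Lemma Lead_src (alpha : cell1 (Lead le G)) :
  src alpha = << lead_mon le (val alpha) >> :> A.
Proof. by case: alpha => a /= /andP[_ a0]; rewrite /lm (negPf a0). Qed.

Lemma Lead_left_monomial : left_monomial (Lead le G).
Proof.
move=> alpha; exists (lead_mon le (val alpha)); first exact: Lead_src.
have := Lead_src alpha; case: alpha => a /= /andP[_ a0] ->.
have [la _] := lead_monP leO a0.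
rewrite -mcoeff_eq0 mcoeffB mcoeffUU mcoeffZ -/(lc le a) mulVf ?subrr //.
by rewrite /lc mcoeff_neq0.
Qed.

Lemma Lead_compatible : compatible le (Lead le G).
Proof.
move=> alpha m n sm nt; have [m' sm' m't] := Lead_left_monomial alpha.
have Em : m' = m by apply: (@malgU_inj K); rewrite -sm' sm.
have El : lead_mon le (val alpha) = m.
  by apply: (@malgU_inj K); rewrite -Lead_src sm.
apply/andP; split; first by apply: contraTneq nt => ->; rewrite -Em.
move: nt; rewrite -El => /(fsubsetP (msuppB_le _ _)); rewrite inE.
have a0 : val alpha != 0 by case: alpha {sm sm' m't El} => a /= /andP[].
rewrite {1}/lm (negPf a0) msuppU1 inE => /orP[/eqP ->|]; first exact: mo_refl.
by move/(fsubsetP (msuppZ_le _ _)); apply: (lead_monP leO a0).2.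
Qed.

(** The boundary of the cell of [a] is [a] divided by its leading coefficient. *)
Lemma Lead_ideal_sub : G `<=` I -> polygraph_ideal (Lead le G) `<=` I.
Proof.
move=> GI; apply: generated_ideal_sub => _ [[a /= aG] _ <-].
rewrite /boundary /= opprB addrC subrK; apply: idealZ; apply: GI.
by case/andP: aG => /set_mem.
Qed.

Lemma grobner_joinable : grobner_basis le I G ->
  forall a b, ideal_set I (a - b) -> joinable (Lead le G) a b.
Proof.
move=> /grobner_basisP[GI H].
apply: (reducible_joinable Lead_left_monomial leO Lead_compatible
  (Lead_ideal_sub GI)).
move=> a Ia /(H a Ia)[g [u [v [Gg g0 ->]]]].
have gP : (g \in G) && (g != 0) by rewrite g0 mem_set.
pose alpha : cell1 (Lead le G) := Sub g gP.
by exists alpha, u, (lead_mon le g), v; rewrite (Lead_src alpha).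
Qed.

Lemma grobner_Lead_ideal : grobner_basis le I G ->
  polygraph_ideal (Lead le G) = I.
Proof.
move=> gb; apply/two_sided_ideal_inj/seteqP; split.
  by apply: Lead_ideal_sub; case: gb.
(* The element 0 is irreducible, so being joinable with it means reducing to
   it. *)
move=> a Ia.
have [|d [ad /rewrites0 d0]] := grobner_joinable gb (a := a) (b := 0).
  by rewrite subr0.
by have := rewrites_ideal ad; rewrite d0 subr0.
Qed.

Lemma grobner_Lead_confluent : grobner_basis le I G -> confluent (Lead le G).
Proof.
move=> gb a b c ab ac; apply: (grobner_joinable gb).
rewrite -(grobner_Lead_ideal gb) -(subrKA a) -[b - a]opprB.
case: (idealP (polygraph_ideal (Lead le G))) => _ ID _ _.
by apply: ID; [apply: idealN|]; apply: rewrites_ideal.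
Qed.

End Grobner.

Lemma alg_isomorphic_refl (K : comPzRingType) (A : pzAlgType K) :
  alg_isomorphic A A.
Proof. by exists idfun; split=> //; exists id. Qed.

Theorem proposition3p5p2 (K : fieldType) :
  (forall (X0 : choiceType) (X : polygraph K X0) (le : rel {fmonom X0}),
     convergent X -> left_monomial X ->
     monomial_order le -> compatible le X ->
     grobner_basis le (polygraph_ideal X) (boundaries X))
  /\
  (forall (X : choiceType) (le : rel {fmonom X})
          (I : two_sided_ideal (free_alg K X)) (G : set (free_alg K X)),
     monomial_order le -> G `<=` I ->
     grobner_basis le I G ->
     [/\ convergent (Lead le G),
         left_monomial (Lead le G),
         presentation (Lead le G) (quot_alg I),
         polygraph_ideal (Lead le G) = I :> set (free_alg K X) &
         compatible le (Lead le G)]).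
Proof.
split=> [X0 X le [_ Xc] Xlm leO leX|X le I G leO GI gb].
  exact: confluent_grobner.
have Xlm := @Lead_left_monomial K X le leO G.
have leX := @Lead_compatible K X le leO G.
have EI := grobner_Lead_ideal leO gb.
split; last exact: leX.
- split; first exact: compatible_terminating leO leX.
  exact: grobner_Lead_confluent gb.
- exact: Xlm.
- rewrite /presentation EI; exact: alg_isomorphic_refl.
- by rewrite EI.
Qed.
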